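(* Let $n,M\ge 1$ be integers and let $k_1,\dots,k_M\in\{1,\dots,n\}$ (not necessarily a monotone sequence). Let $S=S_{n,(k_1,\dots,k_M)}$ be the generalized multi-state $k$-out-of-$n$:G system given by $(k_1,\dots,k_M)$. Then for every $1\le j\le M$ the $j$-reliability ideal of $S$ is $$I_{S,j}=I_{n,(k_j,\dots,k_M)}=\sum_{i=j}^{M} I_{(k_i,n),i},$$ where for integers $1\le k\le n$ and $i\ge 1$, $$I_{(k,n),i}=\Big\langle \prod_{l\in\sigma}x_l^{\,i}\ :\ \sigma\subseteq\{1,\dots,n\},\ |\sigma|=k\Big\rangle\subseteq\mathbf{k}[x_1,\dots,x_n].$$
   Context: $\mathbf{k}$ is a field. The system has $n$ components; each component and the system itself have state set $\{0,1,\dots,M\}$. For a tuple of component states $\mathbf{s}=(s_1,\dots,s_n)$ let $N_l(\mathbf{s})$ be the number of components in state $l$ or above. The generalized multi-state $k$-out-of-$n$:G system $S_{n,(k_1,\dots,k_M)}$ is the system whose structure function $\phi$ satisfies, for $1\le j\le M$: $\phi(\mathbf{s})\ge j$ if and only if there is an integer $l$ with $j\le l\le M$ such that $N_l(\mathbf{s})\ge k_l$ (at least $k_l$ components are in state $l$ or above). A tuple $\mathbf{s}$ corresponds to the monomial $x_1^{s_1}\cdots x_n^{s_n}$, and the $j$-reliability ideal $I_{S,j}$ is the monomial ideal generated by the monomials corresponding to all tuples $\mathbf{s}$ of component states with $\phi(\mathbf{s})\ge j$. The notation $I_{n,(k_j,\dots,k_M)}$ is simply another name for the $j$-reliability ideal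 of $S_{n,(k_1,\dots,k_M)}$. *)

(* Defs.v *)
From mathcomp Require Import all_boot all_order all_algebra.
From mathcomp Require Export mpoly.

Set Implicit Arguments.
Unset Strict Implicit.
Unset Printing Implicit Defensive.

Import GRing.Theory.

Local Open Scope ring_scope.

(* The ideals of ring_quotient.v are proper and boolean; here an ideal is the
   Prop-valued predicate of its elements, and two ideals are equal when they
   have the same elements. *)
Section Ideals.

Variable A : comNzRingType.

Definition ideal_gen (G : A -> Prop) : A -> Prop := fun p =>
  exists2 cs : seq (A * A),
    (forall c, c \in cs -> G c.2) & p = \sum_(c <- cs) c.1 * c.2.

Definition ideal_sum (a b : nat) (I : nat -> A -> Prop) : A -> Prop := fun p =>
  exists2 g : nat -> A,
    (forall i, (a <= i <= b)%N -> I i (g i)) & p = \sum_(a <= i < b.+1) g i.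

End Ideals.

Section System.

Variables n M : nat.

Definition states := {ffun 'I_n -> 'I_M.+1}.

Definition num_ge (l : nat) (s : states) : nat := #|[set c : 'I_n | (l <= s c)%N]|.

(* [k : nat -> nat] stands for the tuple (k_1, ..., k_M): only the values
   [k 1], ..., [k M] are used. *)
Definition is_gkn_structure (k : nat -> nat) (phi : states -> 'I_M.+1) : Prop :=
  forall (s : states) (j : nat), (1 <= j <= M)%N ->
    (j <= phi s)%N <-> exists2 l : nat, (j <= l <= M)%N & (k l <= num_ge l s)%N.

(* The only function satisfying [is_gkn_structure k]: the maximum is 0 when no
   level is reached. *)
Definition gkn_structure (k : nat -> nat) (s : states) : 'I_M.+1 :=
  inord (\max_(l < M.+1 | (0 < l) && (k l <= num_ge l s)) l)%N.

Lemma gkn_structureP (k : nat -> nat) : is_gkn_structure k (gkn_structure k).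
Proof.
move=> s j /andP[j_gt0 leMj]; rewrite /gkn_structure inordK; last first.
  by rewrite ltnS; apply/bigmax_leqP => l _; rewrite -ltnS.
split=> [|[l /andP[lejl lelM] kl]].
  pose P := [pred l : 'I_M.+1 | (0 < l)%N && (k l <= num_ge l s)%N].
  rewrite (eq_bigl P) // => lejm.
  have [l0 Pl0|P0] := pickP P; last first.
    by move: lejm; rewrite big_pred0 // leqNgt j_gt0.
  have: (0 < #|P|)%N by apply/card_gt0P; exists l0.
  case/(eq_bigmax_cond (fun l : 'I_M.+1 => l : nat)) => l Pl defm.
  exists (l : nat); last by case/andP: Pl.
  by apply/andP; split; [rewrite -defm | rewrite -ltnS].
have ltlM : (l < M.+1)%N by [].
apply: (@bigmax_sup _ (Ordinal ltlM)) => //=.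
by rewrite kl andbT (leq_trans j_gt0).
Qed.

Lemma gkn_structure_uniq (k : nat -> nat) (phi psi : states -> 'I_M.+1) :
  is_gkn_structure k phi -> is_gkn_structure k psi -> phi =1 psi.
Proof.
have le phi1 phi2 s : is_gkn_structure k phi1 -> is_gkn_structure k phi2 ->
  (phi1 s <= phi2 s)%N.
  move=> h1 h2; case: (posnP (phi1 s)) => [-> //|gt0].
  have hj : (1 <= phi1 s <= M)%N by rewrite gt0 -ltnS ltn_ord.
  by apply/(h2 s _ hj)/(h1 s _ hj).
by move=> h1 h2 s; apply/val_inj/eqP; rewrite eqn_leq !le.
Qed.

End System.

Section ReliabilityIdeals.

Variables (K : fieldType) (n : nat).

Definition state_monomial M (s : states n M) : {mpoly K[n]} :=
  \prod_(c < n) 'X_c ^+ s c.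

Definition reliability_ideal M (phi : states n M -> 'I_M.+1) (j : nat) :
    {mpoly K[n]} -> Prop :=
  ideal_gen (fun m => exists2 s : states n M, (j <= phi s)%N & m = state_monomial s).

(* I_{n,(k_j,...,k_M)}; [k] is still indexed from 1, and only [k j], ..., [k M]
   matter. *)
Definition gkn_ideal M (k : nat -> nat) (j : nat) : {mpoly K[n]} -> Prop :=
  reliability_ideal (@gkn_structure n M k) j.

(* I_{(k,n),i} *)
Definition kn_ideal (k i : nat) : {mpoly K[n]} -> Prop :=
  ideal_gen (fun m => exists2 sigma : {set 'I_n},
    #|sigma| = k & m = \prod_(l in sigma) 'X_l ^+ i).

End ReliabilityIdeals.

(* Main.v *)
(** If at least [k_l] components of [s] are in state [l] or above, pick [k_l] of
    them: the monomial of [s] is divisible by the product of the [x_c ^ l] over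
    the chosen [c]. Conversely that product is the monomial of the state equal to
    [l] on the chosen components and to 0 elsewhere, which reaches level [l]. *)

Require Import Defs.
From mathcomp Require Import all_boot all_order all_algebra.

Set Implicit Arguments.
Unset Strict Implicit.
Unset Printing Implicit Defensive.

Import GRing.Theory.

Section Ideals.

Local Open Scope ring_scope.

Variable A : comNzRingType.

Definition is_ideal (I : A -> Prop) : Prop :=
  [/\ I 0, forall p q, I p -> I q -> I (p + q) & forall a p, I p -> I (a * p)].

(** Combinations are lists of coefficient-generator pairs: concatenating lists adds them, and
    scaling the first components multiplies them. *)
Lemma ideal_gen_ideal (G : A -> Prop) : is_ideal (ideal_gen G).
Proof.
split=> [|p q [cs Gcs ->] [ds Gds ->]|a p [cs Gcs ->]].
- by exists [::] => //; rewrite big_nil.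
- exists (cs ++ ds); last by rewrite big_cat.
  by move=> c; rewrite mem_cat => /orP[/Gcs|/Gds].
- exists [seq (a * c.1, c.2) | c <- cs].
    by move=> _ /mapP[c /Gcs Gc ->].
  by rewrite big_map mulr_sumr; apply: eq_bigr => c _; rewrite mulrA.
Qed.

Lemma mem_ideal_gen (G : A -> Prop) p : G p -> ideal_gen G p.
Proof.
move=> Gp; exists [:: (1, p)]; last by rewrite big_seq1 mul1r.
by move=> c; rewrite inE => /eqP ->.
Qed.

(** Minimality of the generated ideal: every inclusion below is thereby checked on generators
    only. *)
Lemma ideal_gen_sub (G I : A -> Prop) : is_ideal I ->
  (forall p, G p -> I p) -> forall p, ideal_gen G p -> I p.
Proof.
case=> I0 ID IM GI p [cs Gcs ->]; rewrite big_seq.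
by apply: big_ind => // c /Gcs/GI/IM.
Qed.

Variables (a b : nat) (I : nat -> A -> Prop).
Hypothesis idealI : forall i, is_ideal (I i).

Lemma ideal_sum_ideal : is_ideal (ideal_sum a b I).
Proof.
split=> [|p q [f If ->] [g Ig ->]|c p [g Ig ->]].
- by exists (fun=> 0) => [i _|]; [case: (idealI i) | rewrite big1].
- exists (fun i => f i + g i); last by rewrite big_split.
  by move=> i le_aib; have [_ ID _] := idealI i; apply: ID; [apply: If|apply: Ig].
- exists (fun i => c * g i); last by rewrite mulr_sumr.
  by move=> i /Ig; have [_ _] := idealI i; apply.
Qed.

Lemma mem_ideal_sum i p : (a <= i <= b)%N -> I i p -> ideal_sum a b I p.
Proof.
(* The family is concentrated at index [i]; the zero entries lie in the other ideals. *)
move=> le_aib Iip; exists (fun l => if l == i then p else 0).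
  by move=> l _; case: eqP => [->|_] //; case: (idealI l).
rewrite (bigD1_seq i) ?iota_uniq ?mem_index_iota ?ltnS//= eqxx big1 ?addr0//.
by move=> l /negPf ->.
Qed.

Lemma ideal_sum_sub (J : A -> Prop) : is_ideal J ->
  (forall i, (a <= i <= b)%N -> forall p, I i p -> J p) ->
  forall p, ideal_sum a b I p -> J p.
Proof.
case=> J0 JD _ IJ p [g Ig ->]; rewrite big_seq.
apply: big_ind => // i; rewrite mem_index_iota ltnS => le_aib.
by apply: (IJ i) => //; apply: Ig.
Qed.

End Ideals.

Lemma exists_subset_card (T : finType) (A : {set T}) m :
  m <= #|A| -> exists2 B : {set T}, B \subset A & #|B| = m.
Proof.
move=> le_mA; exists [set x in take m (enum A)].
  by apply/subsetP=> x; rewrite inE => /mem_take; rewrite mem_enum.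
by rewrite cardsE (card_uniqP _) ?take_uniq ?enum_uniq// size_takel// -cardE.
Qed.

Section Generators.

Local Open Scope ring_scope.

Variables (K : fieldType) (n M : nat).

Lemma state_monomial_kn_ideal (k l : nat) (s : states n M) :
  (k <= num_ge l s)%N -> kn_ideal k l (state_monomial K s).
Proof.
case/exists_subset_card=> sigma /subsetP sub_sigma card_sigma.
have [_ _ IM] := ideal_gen_ideal (fun m : {mpoly K[n]} =>
  exists2 sigma : {set 'I_n}, #|sigma| = k & m = \prod_(l0 in sigma) 'X_l0 ^+ l).
(* The first product is the cofactor. The truncated subtraction [s c - l] is exact, since [sigma]
   consists of components in state at least [l]. *)
suff -> : state_monomial K s =
    \prod_(c < n) 'X_c ^+ (if c \in sigma then s c - l else s c)%N
    * \prod_(c in sigma) 'X_c ^+ l.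
  by apply/IM/mem_ideal_gen; exists sigma.
rewrite [\prod_(c in _) _]big_mkcond -big_split /=; apply: eq_bigr => c _.
case: ifP => [/sub_sigma|_]; last by rewrite mulr1.
by rewrite inE => le_ls; rewrite -exprD subnK.
Qed.

(** [inord l] has value [l] only for [l <= M] and defaults to 0 otherwise, hence the bound in the
    next two lemmas. *)
Definition const_state (sigma : {set 'I_n}) (l : nat) : states n M :=
  [ffun c => if c \in sigma then inord l else ord0].

(** Only an inequality, because at [l = 0] the components outside [sigma] are counted too. *)
Lemma num_ge_const_state (sigma : {set 'I_n}) l : (l <= M)%N ->
  (#|sigma| <= num_ge l (const_state sigma l))%N.
Proof.
move=> le_lM; apply/subset_leq_card/subsetP => c c_sigma.
by rewrite inE ffunE c_sigma inordK.
Qed.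

Lemma state_monomial_const_state (sigma : {set 'I_n}) l : (l <= M)%N ->
  state_monomial K (const_state sigma l) = \prod_(c in sigma) 'X_c ^+ l.
Proof.
move=> le_lM; rewrite [RHS]big_mkcond; apply: eq_bigr => c _.
by rewrite ffunE; case: ifP => // _; rewrite inordK.
Qed.

(** Uniqueness of the structure function is pointwise, so it is transferred to ideals through their
    generators. *)
Lemma reliability_ideal_eq (phi psi : states n M -> 'I_M.+1) j p :
  phi =1 psi -> reliability_ideal phi j p -> @reliability_ideal K n M psi j p.
Proof.
move=> eq_phi; apply: ideal_gen_sub; first exact: ideal_gen_ideal.
by move=> _ [s le_j ->]; apply: mem_ideal_gen; exists s; rewrite -?eq_phi.
Qed.

End Generators.

Theorem proposition4p3 (K : fieldType) (n M : nat) (hn : (1 <= n)%N) (hM : (1 <= M)%N)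
  (k : nat -> nat) (hk : forall i : nat, (1 <= i <= M)%N -> (1 <= k i <= n)%N)
  (phi : states n M -> 'I_M.+1) (hphi : is_gkn_structure k phi)
  (j : nat) (hj : (1 <= j <= M)%N) :
  (forall p : {mpoly K[n]}, reliability_ideal phi j p <-> gkn_ideal M k j p) /\
  (forall p : {mpoly K[n]},
     gkn_ideal M k j p <-> ideal_sum j M (fun i => kn_ideal (k i) i) p).
Proof.
have structP := @gkn_structureP n M k.
split=> p; split.
- exact/reliability_ideal_eq/(gkn_structure_uniq hphi structP).
- exact/reliability_ideal_eq/(gkn_structure_uniq structP hphi).
- have ideal_kn i : is_ideal (@kn_ideal K n (k i) i) by exact: ideal_gen_ideal.
  apply: ideal_gen_sub; first exact: ideal_sum_ideal.
  (* The level [l] that witnesses [j <= phi s] selects the summand containing the monomial of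
     [s]. *)
  move=> _ [s /(structP s j hj)[l le_jlM le_k] ->].
  by apply: (mem_ideal_sum ideal_kn le_jlM); apply: state_monomial_kn_ideal.
- apply: ideal_sum_sub; first exact: ideal_gen_ideal.
  move=> i le_jiM; apply: ideal_gen_sub; first exact: ideal_gen_ideal.
  have /andP[_ le_iM] := le_jiM.
  move=> _ [sigma card_sigma ->]; apply: mem_ideal_gen.
  exists (const_state M sigma i); last by rewrite state_monomial_const_state.
  (* The level [i] reached on [sigma] lies between [j] and [M], so it witnesses that the system is
     in state at least [j]. *)
  apply/(structP _ j hj); exists i => //.
  by rewrite -card_sigma num_ge_const_state.
Qed.
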